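(* Let $a,b,c$ be unit quaternions and let $$G(a,b,c)=\begin{bmatrix}1&1&1&1&1\\1&-1&a&b&c\\1&a&-1&c&b\\1&b&c&-1&a\\1&c&b&a&-1\end{bmatrix}.$$ Suppose $G(a,b,c)$ is a quaternionic Hadamard matrix. Then, up to an automorphism of $\mathbb H$ (applied to every entry), $G(a,b,c)$ equals $$\begin{bmatrix}1&1&1&1&1\\1&-1&\mathbf i&\mathbf i e^{\frac{2\pi}{3}\mathbf j}&\mathbf i e^{\frac{4\pi}{3}\mathbf j}\\1&\mathbf i&-1&\mathbf i e^{\frac{4\pi}{3}\mathbf j}&\mathbf i e^{\frac{2\pi}{3}\mathbf j}\\1&\mathbf i e^{\frac{2\pi}{3}\mathbf j}&\mathbf i e^{\frac{4\pi}{3}\mathbf j}&-1&\mathbf i\\1&\mathbf i e^{\frac{4\pi}{3}\mathbf j}&\mathbf i e^{\frac{2\pi}{3}\mathbf j}&\mathbf i&-1\end{bmatrix},$$ i.e., there is an algebra automorphism $f$ of $\mathbb H$ such that applying $f$ to each entry of $G(a,b,c)$ gives this matrix; in particular $G(a,b,c)$ is equivalent to this matrix as a quaternionic Hadamard matrix.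
   Context: $\mathbb H$ is the real algebra of quaternions with basic units $\mathbf i,\mathbf j,\mathbf k$ ($\mathbf i\mathbf j=\mathbf k=-\mathbf j\mathbf i$, squares equal to $-1$). For a quaternion $w$ with $w^2=-1$ and $t\in\mathbb R$, $e^{wt}=\cos t+w\sin t$. A quaternionic Hadamard matrix (QHM) of order $n$ is an $n\times n$ matrix $G$ with unit-norm quaternion entries such that $GG^*=nI_n$, where $G^*$ is the conjugate transpose. Two QHMs are equivalent if one can be obtained from the other by multiplying rows on the left by unit quaternions, multiplying columns on the right by unit quaternions, interchanging rows, or interchanging columns. *)

(* Defs.v *)
From HB Require Import structures.
From mathcomp Require Import all_boot all_order all_algebra ring.
From mathcomp Require Import reals trigo.

Set Implicit Arguments.
Unset Strict Implicit.
Unset Printing Implicit Defensive.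

Import Order.TTheory GRing.Theory Num.Theory.
Local Open Scope ring_scope.

(* Quat t x y z stands for t + x i + y j + z k. *)
Record quaternion (R : Type) := Quat { qre : R; qim_i : R; qim_j : R; qim_k : R }.

Definition quat_tuple (R : Type) (x : quaternion R) :=
  (qre x, qim_i x, qim_j x, qim_k x).
Definition tuple_quat (R : Type) (t : R * R * R * R) :=
  let: (a, b, c, d) := t in Quat a b c d.

Lemma quat_tupleK (R : Type) : cancel (@quat_tuple R) (@tuple_quat R).
Proof. by case. Qed.

HB.instance Definition _ (R : eqType) :=
  Equality.copy (quaternion R) (can_type (@quat_tupleK R)).
HB.instance Definition _ (R : choiceType) :=
  Choice.copy (quaternion R) (can_type (@quat_tupleK R)).

Section QuaternionAlgebra.
Variable R : comNzRingType.
Implicit Types x y z : quaternion R.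

Definition addq x y :=
  Quat (qre x + qre y) (qim_i x + qim_i y) (qim_j x + qim_j y) (qim_k x + qim_k y).
Definition oppq x := Quat (- qre x) (- qim_i x) (- qim_j x) (- qim_k x).
Definition mulq x y :=
  let: Quat a1 b1 c1 d1 := x in let: Quat a2 b2 c2 d2 := y in
  Quat (a1 * a2 - b1 * b2 - c1 * c2 - d1 * d2)
       (a1 * b2 + b1 * a2 + c1 * d2 - d1 * c2)
       (a1 * c2 - b1 * d2 + c1 * a2 + d1 * b2)
       (a1 * d2 + b1 * c2 - c1 * b2 + d1 * a2).
Definition scaleq (r : R) x :=
  Quat (r * qre x) (r * qim_i x) (r * qim_j x) (r * qim_k x).

Lemma addqA : associative addq.
Proof. by move=> [????] [????] [????]; congr Quat; apply: addrA. Qed.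
Lemma addqC : commutative addq.
Proof. by move=> [????] [????]; congr Quat; apply: addrC. Qed.
Lemma add0q : left_id (Quat 0 0 0 0) addq.
Proof. by move=> [????]; congr Quat; apply: add0r. Qed.
Lemma addNq : left_inverse (Quat 0 0 0 0) oppq addq.
Proof. by move=> [????]; congr Quat; apply: addNr. Qed.

HB.instance Definition _ :=
  GRing.isZmodule.Build (quaternion R) addqA addqC add0q addNq.

Lemma mulqA : associative mulq.
Proof. by move=> [????] [????] [????] /=; congr Quat => /=; ring. Qed.
Lemma mul1q : left_id (Quat 1 0 0 0) mulq.
Proof. by move=> [????] /=; congr Quat => /=; ring. Qed.
Lemma mulq1 : right_id (Quat 1 0 0 0) mulq.
Proof. by move=> [????] /=; congr Quat => /=; ring. Qed.
Lemma mulqDl : left_distributive mulq +%R.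
Proof. by move=> [????] [????] [????] /=; congr Quat => /=; ring. Qed.
Lemma mulqDr : right_distributive mulq +%R.
Proof. by move=> [????] [????] [????] /=; congr Quat => /=; ring. Qed.
Lemma oneq_neq0 : Quat 1 0 0 0 != 0 :> quaternion R.
Proof. by apply/eqP => -[] /eqP; rewrite oner_eq0. Qed.

HB.instance Definition _ := GRing.Zmodule_isNzRing.Build (quaternion R)
  mulqA mul1q mulq1 mulqDl mulqDr oneq_neq0.

Lemma scaleqA (r s : R) x : scaleq r (scaleq s x) = scaleq (r * s) x.
Proof. by congr Quat; apply: mulrA. Qed.
Lemma scale1q : left_id 1 scaleq.
Proof. by move=> [????]; congr Quat; apply: mul1r. Qed.
Lemma scaleqDr : right_distributive scaleq +%R.
Proof. by move=> r [????] [????]; congr Quat; apply: mulrDr. Qed.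
Lemma scaleqDl x : {morph scaleq^~ x : r s / r + s}.
Proof. by move=> r s; congr Quat; apply: mulrDl. Qed.

HB.instance Definition _ := GRing.Zmodule_isLmodule.Build R (quaternion R)
  scaleqA scale1q scaleqDr scaleqDl.

Lemma scaleqAl (r : R) x y : r *: (x * y) = (r *: x) * y.
Proof. by case: x y => [????] [????]; congr Quat => /=; ring. Qed.
Lemma scaleqAr (r : R) x y : r *: (x * y) = x * (r *: y).
Proof. by case: x y => [????] [????]; congr Quat => /=; ring. Qed.

HB.instance Definition _ :=
  GRing.Lmodule_isLalgebra.Build R (quaternion R) scaleqAl.
HB.instance Definition _ :=
  GRing.Lalgebra_isAlgebra.Build R (quaternion R) scaleqAr.

Definition qi : quaternion R := Quat 0 1 0 0.
Definition qj : quaternion R := Quat 0 0 1 0.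
Definition qk : quaternion R := Quat 0 0 0 1.

Lemma qiqj : qi * qj = qk.
Proof. by congr Quat => /=; ring. Qed.
Lemma qjqi : qj * qi = - qk.
Proof. by congr Quat => /=; ring. Qed.
Lemma qiqi : qi * qi = -1.
Proof. by congr Quat => /=; ring. Qed.
Lemma qjqj : qj * qj = -1.
Proof. by congr Quat => /=; ring. Qed.
Lemma qkqk : qk * qk = -1.
Proof. by congr Quat => /=; ring. Qed.

Definition qconj x := Quat (qre x) (- qim_i x) (- qim_j x) (- qim_k x).

Definition qconj_tr m n (A : 'M[quaternion R]_(m, n)) : 'M[quaternion R]_(n, m) :=
  map_mx qconj A^T.

End QuaternionAlgebra.

Arguments qi {R}.
Arguments qj {R}.
Arguments qk {R}.

Definition qnorm (R : rcfType) (x : quaternion R) : R :=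
  Num.sqrt (qre x ^+ 2 + qim_i x ^+ 2 + qim_j x ^+ 2 + qim_k x ^+ 2).

(* e^{w t}; meaningful only when w ^+ 2 = -1. *)
Definition qexp (R : realType) (w : quaternion R) (t : R) : quaternion R :=
  (cos t)%:A + sin t *: w.

Section QuaternionicHadamard.
Variables (R : rcfType) (n : nat).
Implicit Types G H K : 'M[quaternion R]_n.

Definition is_QHM G : Prop :=
  (forall i j, qnorm (G i j) = 1) /\ G *m qconj_tr G = n%:R%:M.

Definition scale_row_left (i : 'I_n) (u : quaternion R) G : 'M[quaternion R]_n :=
  \matrix_(k, l) (if k == i then u * G k l else G k l).
Definition scale_col_right (j : 'I_n) (u : quaternion R) G : 'M[quaternion R]_n :=
  \matrix_(k, l) (if l == j then G k l * u else G k l).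

Inductive QHM_move G : 'M[quaternion R]_n -> Prop :=
| move_scale_row i u of qnorm u = 1 : QHM_move G (scale_row_left i u G)
| move_scale_col j u of qnorm u = 1 : QHM_move G (scale_col_right j u G)
| move_swap_rows i1 i2 : QHM_move G (xrow i1 i2 G)
| move_swap_cols j1 j2 : QHM_move G (xcol j1 j2 G).

Inductive QHM_reachable G : 'M[quaternion R]_n -> Prop :=
| reachable_refl : QHM_reachable G G
| reachable_step H K of QHM_reachable G H & QHM_move H K : QHM_reachable G K.

Definition QHM_equivalent G H : Prop :=
  [/\ is_QHM G, is_QHM H & QHM_reachable G H].

End QuaternionicHadamard.

(* Matrix with the given rows; only used on lists of n lists of length n. *)
Definition mx_of_rows (V : nmodType) n (rows : seq (seq V)) : 'M[V]_n :=
  \matrix_(i, j) nth 0 (nth [::] rows i) j.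

Definition G5 (R : realType) (a b c : quaternion R) : 'M[quaternion R]_5 :=
  mx_of_rows 5
    [:: [:: 1;  1;  1;  1;  1];
        [:: 1; -1;  a;  b;  c];
        [:: 1;  a; -1;  c;  b];
        [:: 1;  b;  c; -1;  a];
        [:: 1;  c;  b;  a; -1]].

Definition G5_standard (R : realType) : 'M[quaternion R]_5 :=
  let e1 := qexp qj (2%:R * pi / 3%:R) in
  let e2 := qexp qj (4%:R * pi / 3%:R) in
  mx_of_rows 5
    [:: [:: 1;       1;       1;       1;       1];
        [:: 1;      -1;      qi; qi * e1; qi * e2];
        [:: 1;      qi;      -1; qi * e2; qi * e1];
        [:: 1; qi * e1; qi * e2;      -1;      qi];
        [:: 1; qi * e2; qi * e1;      qi;      -1]].

(* Main.v *)
(* Orthogonality of the first row with the second gives a + b + c = 0, whence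
   <a, b> = <a, c> = <b, c> = -1/2 since a, b, c have norm 1.  Orthogonality of
   row 2 with rows 3 and 4 reads 1 - 2 Re a + 2 <b, c> = 0 and
   1 - 2 Re b + 2 <a, c> = 0, so a and b are purely imaginary and at angle 2 pi / 3.
   A rotation of the imaginary quaternions takes such a pair to (i, i e^{2 pi j / 3}),
   and then c = - a - b to i e^{4 pi j / 3}.  Rotations are conjugations by a unit
   quaternion u; conjugating every entry multiplies all rows on the left by u and
   all columns on the right by the conjugate of u, hence the equivalence. *)
Require Import Defs.
From HB Require Import structures.
From mathcomp Require Import all_boot all_order all_algebra.
From mathcomp Require Import ring lra.
From mathcomp Require Import reals trigo.

Set Implicit Arguments.
Unset Strict Implicit.
Unset Printing Implicit Defensive.

Import GRing.Theory Num.Theory.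
Local Open Scope ring_scope.

(** The square of [qnorm], free of roots, so that multiplicativity is a polynomial identity over any
    commutative ring. *)
Definition qnormsq (R : comNzRingType) (x : quaternion R) : R :=
  qre x ^+ 2 + qim_i x ^+ 2 + qim_j x ^+ 2 + qim_k x ^+ 2.

Lemma qmul_conjr (R : comNzRingType) (x : quaternion R) :
  x * qconj x = (qnormsq x)%:A.
Proof. by case: x => [????]; rewrite /qnormsq; congr Quat => /=; ring. Qed.

Lemma qmul_conjl (R : comNzRingType) (x : quaternion R) :
  qconj x * x = (qnormsq x)%:A.
Proof. by case: x => [????]; rewrite /qnormsq; congr Quat => /=; ring. Qed.

Lemma qconjM (R : comNzRingType) (x y : quaternion R) :
  qconj (x * y) = qconj y * qconj x.
Proof. by case: x y => [????] [????]; congr Quat => /=; ring. Qed.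

Lemma qconjK (R : comNzRingType) : involutive (@qconj R).
Proof. by case=> [????]; congr Quat => /=; ring. Qed.

Lemma qnormsqM (R : comNzRingType) (x y : quaternion R) :
  qnormsq (x * y) = qnormsq x * qnormsq y.
Proof. by case: x y => [????] [????]; rewrite /qnormsq /=; ring. Qed.

Lemma qnormsq_ge0 (R : realDomainType) (x : quaternion R) : 0 <= qnormsq x.
Proof. by rewrite /qnormsq !addr_ge0 ?sqr_ge0. Qed.

Lemma qnormsq_eq0 (R : realDomainType) (x : quaternion R) :
  (qnormsq x == 0) = (x == 0).
Proof.
apply/eqP/eqP => [|->]; last by rewrite /qnormsq /= !expr0n /= !addr0.
case: x => [x0 x1 x2 x3] /eqP; rewrite /qnormsq /=.
rewrite !paddr_eq0 ?addr_ge0 ?sqr_ge0 // !sqrf_eq0.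
by case/andP=> /andP[/andP[/eqP-> /eqP->] /eqP->] /eqP->.
Qed.

Lemma qnorm_eq1 (R : rcfType) (x : quaternion R) :
  qnorm x = 1 <-> qnormsq x = 1.
Proof.
rewrite /qnorm -/(qnormsq x); split=> [h|->]; last exact: sqrtr1.
by rewrite -(sqr_sqrtr (qnormsq_ge0 x)) h expr1n.
Qed.

Lemma qnorm_conj (R : rcfType) (x : quaternion R) : qnorm (qconj x) = qnorm x.
Proof. by rewrite /qnorm /= !sqrrN. Qed.

Lemma qnormM1 (R : rcfType) (x y : quaternion R) :
  qnorm x = 1 -> qnorm y = 1 -> qnorm (x * y) = 1.
Proof. by rewrite !qnorm_eq1 qnormsqM => -> ->; rewrite mulr1. Qed.

Lemma exists_unit_scale (R : rcfType) (v : quaternion R) :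
  v != 0 -> exists r : R, qnorm (r *: v) = 1.
Proof.
rewrite -qnormsq_eq0 => v0; exists (Num.sqrt (qnormsq v))^-1.
apply/qnorm_eq1.
have -> : qnormsq ((Num.sqrt (qnormsq v))^-1 *: v) =
    (Num.sqrt (qnormsq v))^-1 ^+ 2 * qnormsq v by rewrite /qnormsq /=; ring.
by rewrite exprVn sqr_sqrtr ?qnormsq_ge0 // mulVf.
Qed.

Section InnerAutomorphism.
Variables (R : rcfType) (u : quaternion R).
Hypothesis hu : qnorm u = 1.

Let uuV : u * qconj u = 1.
Proof. by rewrite qmul_conjr (qnorm_eq1 u).1 // scale1r. Qed.

Let uVu : qconj u * u = 1.
Proof. by rewrite qmul_conjl (qnorm_eq1 u).1 // scale1r. Qed.

(* The proof of unit norm is an argument so that [inner] can carry a canonical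
   morphism structure. *)
Definition inner (_ : qnorm u = 1) (x : quaternion R) := u * x * qconj u.

Fact inner_linear : linear (inner hu).
Proof.
by move=> r x y; rewrite /inner mulrDr mulrDl -scalerAr -scalerAl.
Qed.

Fact inner_monoid_morphism : monoid_morphism (inner hu).
Proof.
split=> [|x y]; rewrite /inner ?mulr1 //.
by rewrite -!mulrA (mulrA (qconj u) u) uVu mul1r.
Qed.

HB.instance Definition _ :=
  GRing.isLinear.Build R (quaternion R) (quaternion R) _ (inner hu) inner_linear.
HB.instance Definition _ :=
  GRing.isMonoidMorphism.Build (quaternion R) (quaternion R) (inner hu)
    inner_monoid_morphism.

Lemma inner_bij : bijective (inner hu).
Proof.
exists (fun x => qconj u * x * u) => x; rewrite /inner -!mulrA.
  by rewrite uVu mulr1 mulrA uVu mul1r.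
by rewrite uuV mulr1 mulrA uuV mul1r.
Qed.

Lemma inner_conj x : inner hu (qconj x) = qconj (inner hu x).
Proof. by rewrite /inner !qconjM qconjK mulrA. Qed.

Lemma qnorm_inner x : qnorm x = 1 -> qnorm (inner hu x) = 1.
Proof. by move=> hx; rewrite !qnormM1 ?qnorm_conj. Qed.

(** Reduces the search for a rotation to an equation without conjugates or inverses. *)
Lemma inner_intertwine p q : u * p = q * u -> inner hu p = q.
Proof. by move=> h; rewrite /inner h -mulrA uuV mulr1. Qed.

Section Matrices.
Variable n : nat.
Implicit Types G H : 'M[quaternion R]_n.

Lemma is_QHM_inner G : is_QHM G -> is_QHM (map_mx (inner hu) G).
Proof.
case=> hn hG; split=> [i j|]; first by rewrite mxE qnorm_inner.
have -> : qconj_tr (map_mx (inner hu) G) = map_mx (inner hu) (qconj_tr G).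
  by apply/matrixP => i j; rewrite !mxE inner_conj.
by rewrite -map_mxM hG map_scalar_mx rmorph_nat.
Qed.

(** A move scales a single row, so the rows in [s] are treated one at a time; [uniq s] ensures that
    none is scaled twice. *)
Lemma reachable_scale_rows G H (s : seq 'I_n) : uniq s -> QHM_reachable G H ->
  QHM_reachable G (\matrix_(i, j) if i \in s then u * H i j else H i j).
Proof.
elim: s => [_ r|k s IH /= /andP[ks us] r].
  by rewrite (_ : (\matrix_(i, j) _) = H) //; apply/matrixP => i j; rewrite mxE.
apply: reachable_step (IH us r) _.
rewrite (_ : (\matrix_(i, j) _) = scale_row_left k u
  (\matrix_(i, j) if i \in s then u * H i j else H i j)); 
  first exact: move_scale_row.
apply/matrixP => i j; rewrite !mxE inE.
by case: eqP => //= ->; rewrite (negPf ks).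
Qed.

Lemma reachable_scale_cols G H (s : seq 'I_n) : uniq s -> QHM_reachable G H ->
  QHM_reachable G (\matrix_(i, j) if j \in s then H i j * qconj u else H i j).
Proof.
elim: s => [_ r|k s IH /= /andP[ks us] r].
  by rewrite (_ : (\matrix_(i, j) _) = H) //; apply/matrixP => i j; rewrite mxE.
apply: reachable_step (IH us r) _.
rewrite (_ : (\matrix_(i, j) _) = scale_col_right k (qconj u)
  (\matrix_(i, j) if j \in s then H i j * qconj u else H i j)).
  by apply: move_scale_col; rewrite qnorm_conj.
apply/matrixP => i j; rewrite !mxE inE.
by case: eqP => //= ->; rewrite (negPf ks).
Qed.

Lemma QHM_equivalent_inner G :
  is_QHM G -> QHM_equivalent G (map_mx (inner hu) G).
Proof.
move=> hG; split=> //; first exact: is_QHM_inner.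
have := reachable_scale_cols (enum_uniq 'I_n)
  (reachable_scale_rows (enum_uniq 'I_n) (reachable_refl G)).
rewrite (_ : (\matrix_(i, j) _) = map_mx (inner hu) G) //.
by apply/matrixP => i j; rewrite !mxE !mem_enum.
Qed.

End Matrices.
End InnerAutomorphism.

Lemma map_G5 (R : realType) (f : {rmorphism quaternion R -> quaternion R})
    (a b c : quaternion R) : map_mx f (G5 a b c) = G5 (f a) (f b) (f c).
Proof.
apply/matrixP => i j; rewrite !mxE.
by case: i => [[|[|[|[|[|i]]]]] //= _]; case: j => [[|[|[|[|[|j]]]]] //= _];
  rewrite ?rmorphN ?rmorph1.
Qed.

Lemma conjugate_to_qi (R : rcfType) (a : quaternion R) : a * a = -1 ->
  exists2 u, qnorm u = 1 & u * a = qi * u.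
Proof.
(* If a^2 = -1 then (a + i) a = -1 + i a = i (a + i). *)
move=> aa; have [/eqP ai|ai] := eqVneq (a + qi) 0.
  exists qj; first by rewrite /qnorm /= !expr0n /= expr1n !add0r addr0 sqrtr1.
  by move: ai; rewrite addr_eq0 => /eqP ->; congr Quat => /=; ring.
have [r hr] := exists_unit_scale ai; exists (r *: (a + qi)) => //.
by rewrite -scalerAl -scalerAr mulrDl mulrDr aa qiqi addrC.
Qed.

(* If w^2 = -1 then (1 - k w) w = w + k = k (1 - k w); here w = (y j + z k) / s,
   so that s (1 - k w) = (s + z) + y i, which commutes with i.  It vanishes when
   w = -k, and then i does the job. *)
Lemma rotate_around_qi (R : rcfType) (s y z : R) :
  0 < s -> y ^+ 2 + z ^+ 2 = s ^+ 2 ->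
  exists2 u, qnorm u = 1 &
    u * qi = qi * u /\ (forall x, u * Quat 0 x y z = Quat 0 x 0 s * u).
Proof.
move=> s0 hyz; have [v0|v0] := eqVneq (Quat (s + z) y 0 0) 0.
  case: v0 => hz hy; exists qi.
    by rewrite /qnorm /= !expr0n /= expr1n add0r !addr0 sqrtr1.
  have -> : z = - s by apply/eqP; rewrite -addr_eq0 addrC hz.
  by rewrite hy; split=> [//|x]; congr Quat => /=; ring.
have [r hr] := exists_unit_scale v0; exists (r *: Quat (s + z) y 0 0) => //.
split=> [|x]; rewrite -scalerAl -scalerAr; congr (_ *: _);
  congr Quat => /=; try ring.
have -> : s * (s + z) = s ^+ 2 + s * z by ring.
by rewrite -hyz; ring.
Qed.

(** For imaginary [a] and [b], [a * b + b * a] equals -2<a, b>, so the last relation fixes the angle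
    2 pi / 3. One rotation takes [a] to i; a second one, about i, brings [b] into the plane of i and
    k. *)
Lemma conjugate_pair (R : rcfType) (s : R) (a b : quaternion R) :
  0 < s -> s ^+ 2 = 3%:R / 4%:R ->
  a * a = -1 -> b * b = -1 -> a * b + b * a = 1 ->
  exists2 u, qnorm u = 1 &
    u * a = qi * u /\ u * b = Quat 0 (- (1 / 2%:R)) 0 s * u.
Proof.
move=> s0 hs aa bb ab; have [u hu ua] := conjugate_to_qi aa.
have Ea := inner_intertwine hu ua.
have Ebb : inner hu b * inner hu b = -1 by rewrite -rmorphM bb rmorphN1.
have Eab : qi * inner hu b + inner hu b * qi = 1.
  by rewrite -Ea -!rmorphM -rmorphD ab rmorph1.
(* [h1] is the real part of the square; [h2] and [h3] are the real and i parts of the anticommutator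
   with i, that is -2x = 1 and 2t = 0. *)
case Eb: (inner hu b) Ebb Eab => [t x y z] /= [h1 _ _ _] [h2 h3 _ _].
have t0 : t = 0 by lra.
have x0 : x = - (1 / 2%:R) by lra.
have hyz : y ^+ 2 + z ^+ 2 = s ^+ 2 by rewrite hs; move: h1; rewrite t0 x0; lra.
have [v hv [vi vb]] := rotate_around_qi s0 hyz.
have ub : u * b = inner hu b * u.
  by rewrite /inner -!mulrA qmul_conjl (qnorm_eq1 u).1 // scale1r mulr1.
exists (v * u); first exact: qnormM1.
by rewrite -!mulrA ua ub Eb !mulrA vi t0 x0 vb.
Qed.

(** Lengths and angles are put as algebraic relations, which any automorphism transports. *)
Lemma G5_QHM_relations (R : realType) (a b c : quaternion R) :
  is_QHM (G5 a b c) ->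
  [/\ c = - a - b, a * a = -1, b * b = -1 & a * b + b * a = 1].
Proof.
case=> hn hG.
have na : qnormsq a = 1 by apply/qnorm_eq1; move: (hn 1 2%:R); rewrite mxE.
have nb : qnormsq b = 1 by apply/qnorm_eq1; move: (hn 1 3%:R); rewrite mxE.
have nc : qnormsq c = 1 by apply/qnorm_eq1; move: (hn 1 4%:R); rewrite mxE.
have h01 := congr1 (fun M : 'M_5 => M 0 1) hG.
have h12 := congr1 (fun M : 'M_5 => M 1 2%:R) hG.
have h13 := congr1 (fun M : 'M_5 => M 1 3%:R) hG.
rewrite !mxE !big_ord_recl !big_ord0 !mxE /= mulr0n in h01 h12 h13.
move: na nb nc h01 h12 h13; rewrite /qnormsq.
case: a b c {hn hG} => [a0 a1 a2 a3] [b0 b1 b2 b3] [c0 c1 c2 c3] /=.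

move=> na nb nc [e0 e1 e2 e3] [f _ _ _] [g _ _ _].
have ec0 : c0 = - a0 - b0 by lra.
have ec1 : c1 = - a1 - b1 by lra.
have ec2 : c2 = - a2 - b2 by lra.
have ec3 : c3 = - a3 - b3 by lra.
subst c0 c1 c2 c3.
(* With c = - a - b, [nc] gives 2<a, b> = -1, hence 2<b, c> = -1, and [f] reduces to -2 a0 = 0;
   likewise [g] for [b0]. *)
have a00 : a0 = 0 by lra.
have b00 : b0 = 0 by lra.
subst a0 b0.
by split; congr Quat => /=; lra.
Qed.

Lemma cos_2pi3 (R : realType) : cos (2%:R * pi / 3%:R) = - (1 / 2%:R) :> R.
Proof.
have p0 := pi_gt0 R; set x : R := pi / 3%:R.
have c0 : 0 < cos x by apply: cos_gt0_pihalf; rewrite /x; apply/andP; split; lra.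
have -> : 2%:R * pi / 3%:R = x *+ 2 by rewrite /x; lra.
have h : cos (x *+ 2 + x) = -1 by rewrite -cospi; congr cos; rewrite /x; lra.
(* The factor [cos x] produces the very monomial that occurs in the expansion of cos 3x, so that
   linear arithmetic can eliminate it. *)
have sc : cos x * sin x ^+ 2 = cos x * (1 - cos x ^+ 2) by rewrite sin2cos2.
rewrite cosD cos_mulr2n sin_mulr2n in h *.
have h2 : (cos x + 1) * (2%:R * cos x - 1) ^+ 2 = 0 by lra.
move/eqP: h2; rewrite mulf_eq0 sqrf_eq0 => /orP[] /eqP h2; first lra.
(* cos 3x = 4 cos^3 x - 3 cos x with 3x = pi leaves the root cos x = 1/2. *)
have -> : cos x = 1 / 2%:R by lra.
by field.
Qed.

Theorem theorem19 (R : realType) (a b c : quaternion R)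
    (ha : qnorm a = 1) (hb : qnorm b = 1) (hc : qnorm c = 1)
    (hG : is_QHM (G5 a b c)) :
  (exists f : {lrmorphism quaternion R -> quaternion R},
      bijective f /\ map_mx f (G5 a b c) = G5_standard R) /\
  QHM_equivalent (G5 a b c) (G5_standard R).
Proof.
have p0 := pi_gt0 R; set t : R := 2%:R * pi / 3%:R.
have s0 : 0 < sin t by apply: sin_gt0_pi; rewrite /t; apply/andP; split; lra.
have ct : cos t = - (1 / 2%:R) by exact: cos_2pi3.
have s2 : sin t ^+ 2 = 3%:R / 4%:R by rewrite sin2cos2 ct; field.
have [ec aa bb ab] := G5_QHM_relations hG.
have [u hu [ua ub]] := conjugate_pair s0 s2 aa bb ab.
(* Since i j = k, i e^{jt} = cos t i + sin t k. *)
have Eb1 : qi * qexp qj t = Quat 0 (- (1 / 2%:R)) 0 (sin t).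
  by rewrite /qexp ct; congr Quat => /=; ring.
(* Doubling the angle keeps the cosine -1/2 and flips the sign of the sine. *)
have Ec : qi * qexp qj (4%:R * pi / 3%:R) = Quat 0 (- (1 / 2%:R)) 0 (- sin t).
  have -> : 4%:R * pi / 3%:R = t *+ 2 by rewrite /t; lra.
  by rewrite /qexp cos_mulr2n sin_mulr2n ct; congr Quat => /=; field.
have E : map_mx (inner hu) (G5 a b c) = G5_standard R.
  rewrite map_G5 ec rmorphB rmorphN /= (inner_intertwine hu ua).
  rewrite (inner_intertwine hu ub).
  rewrite /G5_standard -/t Eb1 Ec /G5.
  rewrite (_ : - qi - _ = Quat 0 (- (1 / 2%:R)) 0 (- sin t)) //.
  by congr Quat => /=; field.
split; last by rewrite -E; exact: QHM_equivalent_inner.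
by exists (inner hu); split=> //; exact: inner_bij.
Qed.
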